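(* Let $q$ be a prime, $n\ge 1$, let $\mathcal{C}\subseteq M_n(\mathbb{F}_q)$ be a similarity class, and let $S\subseteq\mathcal{C}$ be a non-core set. Then $|S|\le \dfrac{4|\mathcal{C}|}{q}$.
   Context: $M_n(F)$ is the ring of $n\times n$ matrices over a field $F$; a similarity class is an orbit of $M_n(F)$ under conjugation by $\mathrm{GL}(n,F)$. In $M_n(F)[x]$ the indeterminate $x$ commutes with all coefficients. Evaluation is with $x$ to the right of the coefficients: for $f=\sum_k B_kx^k$ and $A\in M_n(F)$, $f(A)=\sum_k B_kA^k$. For $S\subseteq M_n(F)$, $N(S)=\{f\in M_n(F)[x] : f(A)=0\ \text{for all } A\in S\}$. $S$ is a core set if $N(S)$ is a two-sided ideal of $M_n(F)[x]$; otherwise it is a non-core set. *)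

(* Defs.v *)
From HB Require Import structures.
From mathcomp Require Import all_boot all_order all_fingroup all_algebra.

Set Implicit Arguments.
Unset Strict Implicit.
Unset Printing Implicit Defensive.

Import GRing.Theory.
Local Open Scope ring_scope.

Section CoreSets.

(* The size is written n.+1 because only 'M[F]_n.+1 carries the nontrivial
   ring structure required to form {poly 'M[F]_n.+1}. *)
Variables (F : finFieldType) (n : nat).

Definition similarity_class (A : 'M[F]_n.+1) : {set 'M[F]_n.+1} :=
  [set GLval g * A * (GLval g)^-1 | g : {'GL_n.+1[F]}].

Definition is_similarity_class (C : {set 'M[F]_n.+1}) : Prop :=
  exists A : 'M[F]_n.+1, C = similarity_class A.

(* f.[A] is the Horner evaluation, in which the argument stands to the right
   of the coefficients: f.[A] = \sum_(k < size f) f`_k * A ^+ k (see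
   horner_coef). *)
Definition null_polys (S : {set 'M[F]_n.+1}) : {pred {poly 'M[F]_n.+1}} :=
  [pred f : {poly 'M[F]_n.+1} | [forall A in S, f.[A] == 0]].

Definition two_sided_ideal (R : pzRingType) (I : {pred R}) : Prop :=
  [/\ zmod_closed I,
      forall a u : R, u \in I -> a * u \in I
    & forall a u : R, u \in I -> u * a \in I].

Definition core_set (S : {set 'M[F]_n.+1}) : Prop :=
  two_sided_ideal (null_polys S).

End CoreSets.

(* Main.v *)
(* Let mu be the minimal polynomial of the class of A. If every null polynomial
   of S of degree < deg mu vanishes, then the null ideal of S is generated by
   the central polynomial mu, so S is core. Hence a non-core S has a null
   polynomial r = \sum_k r_k x^k <> 0 with deg r < deg mu, and g A g^-1 \in S
   forces D(g) = 0 where D(U) = \sum_k r_k U A^k. The map D is linear and, since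
   no nonzero scalar polynomial of degree < deg mu kills A, nonzero on some
   elementary matrix E. So each line U + F E contains at most one zero of D,
   whereas a line through an invertible U has at least q - 1 invertible points.
   This gives (q - 1) |S| <= |C|, and q <= 2 (q - 1). *)
Require Import Defs.
From HB Require Import structures.
From mathcomp Require Import all_boot all_order all_fingroup all_algebra.

Set Implicit Arguments.
Unset Strict Implicit.
Unset Printing Implicit Defensive.

Import Order.TTheory GRing.Theory Num.Theory.
Local Open Scope ring_scope.

Section NonCoreBound.

Variables (F : finFieldType) (n : nat).
Implicit Types (A B E U : 'M[F]_n.+1) (S : {set 'M[F]_n.+1}).
Implicit Types (f r : {poly 'M[F]_n.+1}) (p : {poly F}) (g h : {'GL_n.+1[F]}).

Definition scalar_poly p : {poly 'M[F]_n.+1} := map_poly scalar_mx p.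

Lemma scalar_poly_comm p f : scalar_poly p * f = f * scalar_poly p.
Proof.
apply/polyP => k; rewrite coefM coefMr; apply: eq_bigr => i _.
by rewrite coef_map; have := scalar_mxC p`_i f`_(k - i).
Qed.

(** Evaluation is not multiplicative in general; here it is, because [A] commutes with the value of
    [scalar_poly p] at [A]. *)
Lemma horner_mul_scalar_poly f p A :
  (f * scalar_poly p).[A] = f.[A] * horner_mx A p.
Proof. by rewrite hornerM_comm //; exact: comm_mx_horner. Qed.

(** Dividing a null polynomial by the monic [scalar_poly p] leaves a null remainder of smaller size,
    hence 0. So every null polynomial is a multiple of a central one. *)
Lemma core_set_of_no_small_null_poly p S :
    p \is monic -> {in S, forall A, horner_mx A p = 0} ->
    (forall r, r \in null_polys S -> (size r < size p)%N -> r = 0) ->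
  core_set S.
Proof.
move=> mon_p pS0 small0.
have mon_sp : scalar_poly p \is monic by apply: monic_map.
have size_sp : size (scalar_poly p) = size p.
  by rewrite size_map_inj_poly ?raddf0 //; exact: fmorph_inj.
have null_mul f : f * scalar_poly p \in null_polys S.
  by apply/forall_inP => A AS; rewrite horner_mul_scalar_poly pS0 ?mulr0.
have null_sub : zmod_closed (null_polys S).
  split=> [|f1 f2 /forall_inP f10 /forall_inP f20]; apply/forall_inP => A AS.
    by rewrite horner0.
  by rewrite hornerD hornerN (eqP (f10 A AS)) (eqP (f20 A AS)) subrr.
have nullE f : f \in null_polys S ->
    f = Pdiv.Ring.rdivp f (scalar_poly p) * scalar_poly p.
  move=> f0; have divE := Pdiv.RingMonic.rdivp_eq mon_sp f.
  rewrite {1}divE [X in _ + X]small0 ?addr0 //.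
    rewrite (_ : Pdiv.CommonRing.rmodp _ _ =
      f - Pdiv.Ring.rdivp f (scalar_poly p) * scalar_poly p).
      by apply: null_sub.2.
    by rewrite {2}divE addrC addKr.
  by rewrite -size_sp Pdiv.Ring.ltn_rmodpN0 ?monic_neq0.
split=> // a f /nullE ->; first by rewrite mulrA.
by rewrite -mulrA scalar_poly_comm mulrA.
Qed.

Lemma mulmx_delta_mx A B i j l s :
  (A *m delta_mx j l *m B) i s = A i j * B l s.
Proof.
rewrite -(mul_delta_mx (ord0 : 'I_1)) mulmxA -colE -mulmxA -rowE.
by rewrite mxE big_ord1 !mxE.
Qed.

(** The map D: moving the inverse of [g] out of the evaluation makes the vanishing condition linear
    in [g]. *)
Definition sandwich_eval r A U : 'M[F]_n.+1 :=
  \sum_(k < size r) r`_k * U * A ^+ k.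

Lemma horner_conj r A g :
  r.[GLval g * A * (GLval g)^-1] = sandwich_eval r A (GLval g) * (GLval g)^-1.
Proof.
have gU : GLval g \is a GRing.unit by exact: GL_unit.
rewrite horner_coef mulr_suml; apply: eq_bigr => k _.
suff -> : (GLval g * A * (GLval g)^-1) ^+ k = GLval g * A ^+ k * (GLval g)^-1.
  by rewrite !mulrA.
elim: (k : nat) => [|m IHm]; first by rewrite !expr0 mulr1 mulrV.
by rewrite !exprSr IHm !mulrA mulrVK.
Qed.

Lemma sandwich_evalDZ r A U E (t : F) :
  sandwich_eval r A (U + t *: E)
    = sandwich_eval r A U + t *: sandwich_eval r A E.
Proof.
rewrite /sandwich_eval scaler_sumr -big_split; apply: eq_bigr => k _ /=.
by rewrite mulrDr mulrDl -scalerAr -scalerAl.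
Qed.

Lemma sandwich_eval_delta r A i j l s :
  sandwich_eval r A (delta_mx j l) i s
    = horner_mx A (\poly_(k < size r) r`_k i j) l s.
Proof.
rewrite poly_def raddf_sum !summxE; apply: eq_bigr => k _ /=.
rewrite horner_mxZ rmorphXn /= horner_mx_X [RHS]mxE.
exact: mulmx_delta_mx.
Qed.

Lemma sandwich_eval_delta_neq0 r A :
    r != 0 -> (size r < size (mxminpoly A))%N ->
  exists j l, sandwich_eval r A (delta_mx j l) != 0.
Proof.
move=> r0 size_r.
(* A nonzero entry of the leading coefficient selects a nonzero scalar polynomial [p], too small to
   be divisible by the minimal polynomial. *)
have /matrix0Pn[i [j rij]] : lead_coef r != 0 by rewrite lead_coef_eq0.
pose p := \poly_(k < size r) r`_k i j.
have p0 : p != 0.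
  apply: contraNneq rij => p0.
  have := congr1 (fun p : {poly F} => p`_(size r).-1) p0.
  rewrite coef_poly coef0 -lead_coefE prednK ?size_poly_gt0 ?leqnn //.
  by move->.
have /matrix0Pn[l [s pls]] : horner_mx A p != 0.
  apply: contraTneq size_r => /mxminpoly_min/dvdp_leq => /(_ p0) le_p.
  by rewrite -leqNgt (leq_trans le_p) ?size_poly.
exists j, l; apply: contraNneq pls => D0.
by rewrite -(sandwich_eval_delta r A i j) D0 mxE.
Qed.

(** Only row [j] varies along the line, and the determinant is linear in that row. *)
Lemma det_line U j l (t : F) :
  \det (U + t *: delta_mx j l)
    = (1 - t) * \det U + t * \det (U + delta_mx j l).
Proof.
apply: (@determinant_multilinear _ _ _ _ _ j).
  by apply/rowP => s; rewrite !mxE mulrBl mul1r mulrDr addrA subrK.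
all: apply/matrixP => a b; rewrite !mxE eq_sym (negPf (neq_lift _ _)).
all: by rewrite ?mulr0 ?addr0.
Qed.

(* On the line [U + t *: delta_mx j l] the determinant is affine in [t] and does
   not vanish at [t = 0], so at most one [t] is excluded. If the determinant is
   constant, the division by [0] below yields [0], a harmless excluded value. *)
Lemma det_line_neq0 U j l (s : F) :
    \det U != 0 -> s != 0 ->
  \det (U + (\det U / (\det U - \det (U + delta_mx j l)) + s) *: delta_mx j l)
    != 0.
Proof.
move=> dU s0; rewrite det_line.
set a := \det U in dU *; set b := \det (U + _); set t := _ + s.
have -> : (1 - t) * a + t * b = a - t * (a - b).
  by rewrite mulrBl mul1r mulrBr opprB addrA addrAC.
have [ab0|ab0] := eqVneq (a - b) 0; first by rewrite ab0 mulr0 subr0.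
by rewrite /t mulrDl divfK // opprD addNKr oppr_eq0 mulf_neq0.
Qed.

(** Each zero [g] of D and each nonzero [s] give an invertible point of the line through [g], at
    offset [s] from the excluded parameter; these points are distinct. *)
Lemma card_GL_line_le r A j l :
    sandwich_eval r A (delta_mx j l) != 0 ->
  (#|[set g : {'GL_n.+1[F]} | sandwich_eval r A (GLval g) == 0%R]| * #|F|.-1
    <= #|[set: {'GL_n.+1[F]}]|)%N.
Proof.
move=> D0; set bad := [set g | _].
pose t (x : {'GL_n.+1[F]} * F) :=
  \det (GLval x.1) / (\det (GLval x.1) - \det (GLval x.1 + delta_mx j l)) + x.2.
pose line x := GLval x.1 + t x *: delta_mx j l.
have line_inj : {in setX bad [set~ 0] &, injective line}.
  move=> [g s] [h u] /[!inE] /andP[/eqP g0 _] /andP[/eqP h0 _] eq_line.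
  have eq_t : t (g, s) = t (h, u).
    (* D vanishes at [g] and [h], so its value at the common point determines the parameter. *)
    have := congr1 (sandwich_eval r A) eq_line.
    rewrite !sandwich_evalDZ /= g0 h0 !add0r => /eqP.
    rewrite -subr_eq0 -scalerBl scaler_eq0 (negPf D0) orbF.
    by rewrite subr_eq0 => /eqP.
  have gh : g = h.
    by apply: val_inj; move: eq_line; rewrite /line eq_t => /addIr.
  by move: eq_t; rewrite /t gh => /addrI /= ->.
rewrite -(cardsC1 (0 : F)) -cardsX -(card_in_imset line_inj).
rewrite -(card_imset _ (val_inj : injective (@GLval n.+1 F))).
apply/subset_leq_card/subsetP => _ /imsetP[[g s] /[!inE] /andP[_ s0] ->].
have lineU : line (g, s) \is a GRing.unit.
  rewrite -[_ \is a _]/(line (g, s) \in unitmx) unitmxE unitfE.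
  by apply: det_line_neq0 => //; exact: (GL_det g).
by apply/imsetP; exists (FinRing.Unit lineU).
Qed.

Lemma card_conj_preim A S :
    S \subset similarity_class A ->
  #|[set g : {'GL_n.+1[F]} | GLval g * A * (GLval g)^-1 \in S]|
    = (#|S|
       * #|[set g : {'GL_n.+1[F]} | (GLval g * A * (GLval g)^-1 == A)%R]|)%N.
Proof.
move=> sSA; set stab := [set g : {'GL_n.+1[F]} | _ == A].
rewrite -sum1_card (partition_big
  (fun g : {'GL_n.+1[F]} => GLval g * A * (GLval g)^-1) (mem S)) /=; last by move=> g /[!inE].
rewrite -sum_nat_const; apply: eq_bigr => X XS.
have /imsetP[h _ defX] := subsetP sSA X XS.
(* The fibre over [X] is the left coset of [stab] by [h]. *)
rewrite sum1_card -(card_lcoset stab h); apply: eq_card => g.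
rewrite mem_lcoset !inE -topredE /= inE.
rewrite -[FinRing.uval h]/(GLval h) -[FinRing.uval g]/(GLval g).
have hU : GLval h \is a GRing.unit by exact: GL_unit.
have VhU : (GLval h)^-1 \is a GRing.unit by rewrite unitrV.
have gU : GLval g \is a GRing.unit by exact: GL_unit.
rewrite invrM // invrK !mulrA.
have -> : ((GLval h)^-1 * GLval g * A * (GLval g)^-1 * GLval h == A)
    = (GLval g * A * (GLval g)^-1 == X).
  rewrite defX -(inj_eq (mulrI hU)) -(inj_eq (mulIr VhU)).
  by rewrite !mulrA divrr // mul1r mulrK.
by rewrite andb_idl // => /eqP ->.
Qed.

Lemma noncore_card_le A S :
    S \subset similarity_class A -> ~ core_set S ->
  (#|S| * #|F|.-1 <= #|similarity_class A|)%N.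
Proof.
move=> sSA ncoreS; case: leqP => // lt_card; case: ncoreS.
apply: (core_set_of_no_small_null_poly (mxminpoly_monic A))
  => [B BS|r r0 size_r].
  have /imsetP[g _ ->] := subsetP sSA B BS.
  have := horner_mx_uconj (mxminpoly A) A (GL_unit g).
  by rewrite mx_root_minpoly mulmx0 mul0mx.
apply/eqP; apply: contraTT lt_card => nz_r; rewrite -leqNgt.
have [j [l Dr]] := sandwich_eval_delta_neq0 nz_r size_r.
pose stab := [set g : {'GL_n.+1[F]} | GLval g * A * (GLval g)^-1 == A].
have stab_gt0 : (0 < #|stab|)%N.
  apply/card_gt0P; exists 1%g; rewrite inE.
  by have -> : GLval (1%g : {'GL_n.+1[F]}) = 1 by []; rewrite invr1 mul1r mulr1.
(* Scaling by the stabilizer order moves the count from the class to the group. *)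
rewrite -(leq_pmul2r stab_gt0) mulnAC -!card_conj_preim //.
rewrite [leqRHS](_ : _ = #|[set: {'GL_n.+1[F]}]|); last first.
  by apply: eq_card => g; rewrite !inE; apply/imsetP; exists g.
apply: leq_trans (card_GL_line_le Dr); rewrite leq_mul2r; apply/orP; right.
apply/subset_leq_card/subsetP => g /[!inE] /(forall_inP r0).
rewrite horner_conj => /eqP/(congr1 (fun M => M * GLval g)).
by rewrite mulrVK ?mul0r; [move-> | exact: GL_unit].
Qed.

End NonCoreBound.

Theorem theorem1p8 (q : nat) (hq : prime q) (n : nat)
    (C : {set 'M['F_q]_n.+1}) (hC : is_similarity_class C)
    (S : {set 'M['F_q]_n.+1}) (hSC : S \subset C) (hS : ~ core_set S) :
  (#|S|%:R : rat) <= 4%:R * #|C|%:R / q%:R.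
Proof.
have [A defC] := hC; rewrite defC in hSC *.
have := noncore_card_le hSC hS; rewrite card_Fp // => le_card.
have q1 := prime_gt1 hq.
rewrite ler_pdivlMr ?ltr0n ?prime_gt0 // -!natrM ler_nat.
have q_le : (q <= 2 * q.-1)%N.
  by rewrite -subn1 mulnBr mul2n -addnn -addnBA // leq_addr.
(* This route yields the constant 2, which is at most 4. *)
apply: leq_trans (leq_mul (leqnn #|S|) q_le) _.
by rewrite mulnCA (leq_mul _ le_card).
Qed.
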